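(* Let $I\subset\mathbb R$ be an open interval and let $t\mapsto p_t$, $t\in I$, be a path of probability densities on $\mathcal O$ with respect to $\mu$ such that, for every $o\in\mathcal O$, $p_t(o)>0$, $t\mapsto p_t(o)$ is differentiable on $I$, and $$\frac{d}{dt}\log p_t(o)=D(p_t)(o),\qquad D(p_t):=\frac1n\sum_{j=1}^n\alpha_j^{(t)}k^{(t)}_{O_j}.$$ Then: (1) the map $t\mapsto P_n[\log p_t]$ is nondecreasing on $I$; (2) for any $t_1\in I$, $$\frac{d}{dt}P_n[\log p_t]\Big|_{t=t_1}=0\quad\Longleftrightarrow\quad m_n^{(t_1)}=0\ \text{ in }\mathcal H_K^{(t_1)}.$$
   Context: $\mathcal O=[0,1]^d\times\{0,1\}\times\{0,1\}$, $\mu$ is the product of Lebesgue measure on $[0,1]^d$ and counting measures on the two copies of $\{0,1\}$. $O_1,\dots,O_n\in\mathcal O$ are the observations and $P_nf=P_n[f]=\frac1n\sum_{i=1}^nf(O_i)$. $K(o,o')=\exp(-\|o-o'\|_2^2/(2\sigma^2))$ ($\sigma>0$ fixed) is the Gaussian kernel on $\mathcal O$, $\mathcal H_K$ its reproducing kernel Hilbert space, $k_o=K(o,\cdot)$. $P^{(t)}$ is the probability measure with density $p_t$; $\mathcal H_K^{(t)}=\{f\in\mathcal H_K:P^{(t)}[f]=0\}$, a closed subspace of $\mathcal H_K$ with inherited inner product; $\Pi_t:\mathcal H_K\to\mathcal H_K^{(t)}$ is the orthogonal projection; $k_o^{(t)}=\Pi_tk_o$; $K^{(t)}(o,o')=\langle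 k_o^{(t)},k_{o'}^{(t)}\rangle_{\mathcal H_K}$ is the reproducing kernel of $\mathcal H_K^{(t)}$; $\alpha_j^{(t)}=P_n[k^{(t)}_{O_j}]=\frac1n\sum_{i=1}^nK^{(t)}(O_i,O_j)$; $m_n^{(t)}=\frac1n\sum_{i=1}^nk^{(t)}_{O_i}\in\mathcal H_K^{(t)}$ is the empirical mean embedding. *)

(* Defs.v *)
From HB Require Import structures.
From mathcomp Require Import all_boot all_order all_algebra.
From mathcomp Require Import all_classical all_reals all_analysis.

Set Implicit Arguments.
Unset Strict Implicit.
Unset Printing Implicit Defensive.
Import Order.TTheory GRing.Theory Num.Theory numFieldNormedType.Exports.

Local Open Scope classical_set_scope.
Local Open Scope ring_scope.

(* An alias, so that the measurable structure below is not attached to [{i01 R}]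
   itself. *)
Definition unit_itv (R : realType) : Type := {i01 R}.

Definition i01val (R : realType) (x : unit_itv R) : R := (x : {i01 R})%:num.

HB.instance Definition _ (R : realType) := Choice.on (unit_itv R).
HB.instance Definition _ (R : realType) :=
  isPointed.Build (unit_itv R) (0%:i01 : {i01 R}).

Section unit_itv_measurable.
Variable R : realType.

Definition unit_itv_measurable : set (set (unit_itv R)) :=
  preimage_set_system setT (@i01val R) measurable.

Let unit_itv0 : unit_itv_measurable set0.
Proof. by exists set0 => //; rewrite preimage_set0 setI0. Qed.

Let unit_itvC A : unit_itv_measurable A -> unit_itv_measurable (~` A).
Proof.
move=> [B mB <-]; exists (~` B); first exact: measurableC.
by rewrite !setTI preimage_setC.
Qed.

Let unit_itv_bigcup (F : (set (unit_itv R))^nat) :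
  (forall i, unit_itv_measurable (F i)) -> unit_itv_measurable (\bigcup_i F i).
Proof.
move=> mF; have [G GE] := choice (fun i => let: ex_intro2 B mB BE := mF i in
  ex_intro (fun B => measurable B /\ setT `&` @i01val R @^-1` B = F i) B
    (conj mB BE)).
exists (\bigcup_i G i).
  by apply: bigcup_measurable => i _; have [] := GE i.
rewrite setTI preimage_bigcup; apply: eq_bigcupr => i _.
by have [_ <-] := GE i; rewrite setTI.
Qed.

HB.instance Definition _ := @isMeasurable.Build default_measure_display
  (unit_itv R) unit_itv_measurable unit_itv0 unit_itvC unit_itv_bigcup.

End unit_itv_measurable.

Section lebesgue01.
Variable R : realType.
Local Open Scope ereal_scope.

Definition lebesgue01 (A : set (unit_itv R)) : \bar R :=
  lebesgue_measure (@i01val R @` A).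

Lemma i01val_inj : injective (@i01val R).
Proof. by move=> x y xy; apply: val_inj. Qed.

Lemma image_i01val_setT :
  @i01val R @` [set: unit_itv R] = `[0%R, 1%R]%classic.
Proof.
apply/seteqP; split=> [_ [x _ <-]|r /=].
  by rewrite /= in_itv /=; apply/andP; split;
    [exact: (ge0 (x : {i01 R}))|exact: (le1 (x : {i01 R}))].
by rewrite in_itv /= => /andP[r0 r1]; exists (Itv01 r0 r1).
Qed.

Lemma measurable_image_i01val (A : set (unit_itv R)) :
  measurable A -> measurable (@i01val R @` A).
Proof.
move=> [B mB <-]; rewrite setTI.
rewrite (_ : _ @` _ = `[0%R, 1%R]%classic `&` B); first exact: measurableI.
rewrite -image_i01val_setT; apply/seteqP; split=> [_ [x /= Bx <-]|_ [[x _ <-] Bx]].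
  by split => //; exists x.
by exists x.
Qed.

Let lebesgue01_0 : lebesgue01 set0 = 0.
Proof. by rewrite /lebesgue01 image_set0 measure0. Qed.

Let lebesgue01_ge0 A : 0 <= lebesgue01 A.
Proof. exact: measure_ge0. Qed.

Let lebesgue01_sigma_additive : semi_sigma_additive lebesgue01.
Proof.
move=> F mF tF mUF; rewrite /lebesgue01 image_bigcup.
apply: measure_semi_sigma_additive.
- by move=> i; exact: measurable_image_i01val.
- apply/trivIsetP => i j _ _ ij; move/trivIsetP : tF => /(_ _ _ Logic.I Logic.I ij) F0.
  apply/seteqP; split=> // r [[x Fx <-] [y Fy /i01val_inj yx]].
  have : (F i `&` F j) x by split => //; rewrite -yx.
  by rewrite F0.
- by rewrite -image_bigcup; exact: measurable_image_i01val.
Qed.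

HB.instance Definition _ := isMeasure.Build _ _ _ lebesgue01
  lebesgue01_0 lebesgue01_ge0 lebesgue01_sigma_additive.

Let lebesgue01_setT : lebesgue01 setT = 1.
Proof.
by rewrite /lebesgue01 image_i01val_setT lebesgue_measure_itv/= lte01 oppr0 adde0.
Qed.

HB.instance Definition _ :=
  Measure_isProbability.Build _ _ _ lebesgue01 lebesgue01_setT.

End lebesgue01.
Arguments lebesgue01 {R}.

Section lebesgue_cube.
Variable R : realType.
Local Open Scope ereal_scope.
Notation I := (unit_itv R).

Definition cons_cube (d : nat) (x : I * d.-tuple I) : d.+1.-tuple I :=
  [tuple of x.1 :: x.2].

Let measurable_cons_cube d : measurable_fun setT (@cons_cube d).
Proof. exact: (measurable_cons measurable_fst measurable_snd). Qed.

HB.instance Definition _ d :=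
  isMeasurableFun.Build _ _ _ _ (@cons_cube d) (@measurable_cons_cube d).

Section product.
Variables (d : nat) (m : probability (d.-tuple I) R).

Definition lebesgue01_prod : set (I * d.-tuple I) -> \bar R := lebesgue01 \x m.

HB.instance Definition _ := Measure.on lebesgue01_prod.

Let lebesgue01_prod_setT : lebesgue01_prod setT = 1.
Proof.
rewrite -setXTT /lebesgue01_prod product_measure1E//.
by rewrite [X in X * _]probability_setT [X in _ * X]probability_setT mule1.
Qed.

HB.instance Definition _ :=
  Measure_isProbability.Build _ _ _ lebesgue01_prod lebesgue01_prod_setT.

End product.

(* Lebesgue measure on the cube; a point mass when [d = 0]. *)
Fixpoint lebesgue_cube (d : nat) : probability (d.-tuple I) R :=
  match d with
  | 0 => \d_[tuple]
  | d'.+1 => distribution (lebesgue01_prod (lebesgue_cube d')) (@cons_cube d')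
  end.

End lebesgue_cube.
Arguments lebesgue_cube {R} d.

Section counting_bool.
Variable R : realType.

Let fin_num_counting_bool : fin_num_fun (@counting bool R).
Proof.
by move=> A _; rewrite /counting asboolT//; exact: finite_finset.
Qed.

HB.instance Definition _ :=
  Measure_isFinite.Build _ _ _ (@counting bool R) fin_num_counting_bool.

End counting_bool.

Notation obs R d := (d.-tuple (unit_itv R) * bool * bool)%type.

Section observations.
Variables (R : realType) (d : nat).

Definition obs_measure : set (obs R d) -> \bar R :=
  ((lebesgue_cube d \x counting) \x counting)%E.

HB.instance Definition _ := Measure.on obs_measure.

Definition sqdist (o o' : obs R d) : R :=
  \sum_(i < d) (i01val (tnth o.1.1 i) - i01val (tnth o'.1.1 i)) ^+ 2
  + (o.1.2%:R - o'.1.2%:R) ^+ 2 + (o.2%:R - o'.2%:R) ^+ 2.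

Definition gauss_kernel (sigma : R) (o o' : obs R d) : R :=
  expR (- sqdist o o' / (2 * sigma ^+ 2)).

Definition is_density (p : obs R d -> R) : Prop :=
  [/\ measurable_fun setT p, forall o, 0 <= p o
    & (\int[obs_measure]_o (p o)%:E = 1)%E].

(* P[f], for P the probability measure with density p *)
Definition density_mean (p f : obs R d -> R) : R :=
  \int[obs_measure]_o (f o * p o).

End observations.

Section rkhs.
Variables (R : realType) (T : Type).
Implicit Types (H V : set (T -> R)) (ip : (T -> R) -> (T -> R) -> R).

(* Only the values of [ip] on [H] matter. *)
Record is_hilbert H ip : Prop := IsHilbert {
  hilbert0 : H 0 ;
  hilbertP : forall (a : R) f g, H f -> H g -> H (a *: f + g) ;
  hilbert_ipC : forall f g, H f -> H g -> ip f g = ip g f ;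
  hilbert_ipP : forall (a : R) f g h, H f -> H g -> H h ->
    ip (a *: f + g) h = a * ip f h + ip g h ;
  hilbert_ip_gt0 : forall f, H f -> f <> 0 -> 0 < ip f f ;
  hilbert_complete : forall u : nat -> T -> R, (forall n, H (u n)) ->
    (forall e : R, 0 < e -> exists N, forall m n, (N <= m)%N -> (N <= n)%N ->
      Num.sqrt (ip (u m - u n) (u m - u n)) < e) ->
    exists2 f, H f &
      (fun n => Num.sqrt (ip (u n - f) (u n - f))) @ \oo --> (0 : R)
}.

(* [H], with inner product [ip], is the reproducing kernel Hilbert space of
   [K]; by Moore-Aronszajn there is exactly one for each positive semidefinite
   [K] (up to the values of [ip] off [H]). *)
Record is_rkhs (K : T -> T -> R) H ip : Prop := IsRKHS {
  rkhs_hilbert : is_hilbert H ip ;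
  rkhs_kernel : forall x, H (K x) ;
  rkhs_reproducing : forall f x, H f -> ip f (K x) = f x
}.

(* The default value 0 is irrelevant when [V] is a closed subspace of a Hilbert
   space: such a [g] then exists and is unique. *)
Definition orth_proj ip V (f : T -> R) : T -> R :=
  xget 0 [set g | V g /\ forall h, V h -> ip (f - g) h = 0].

End rkhs.

Definition emp_mean (R : realType) (T : Type) (n : nat) (O : 'I_n -> T)
    (f : T -> R) : R :=
  n%:R^-1 * \sum_(i < n) f (O i).

Definition emp_loglik (R : realType) (T : Type) (n : nat) (O : 'I_n -> T)
    (p : R -> T -> R) (t : R) : R :=
  emp_mean O (fun o => ln (p t o)).

(* The objects attached to the Gaussian kernel, its RKHS ([H], [ip]), and one
   density [p]. *)
Section score.
Variables (R : realType) (d : nat) (sigma : R).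
Variables (H : set (obs R d -> R)) (ip : (obs R d -> R) -> (obs R d -> R) -> R).
Variable p : obs R d -> R.

(* H_K^(t) *)
Definition mean_zero : set (obs R d -> R) :=
  [set f | H f /\ density_mean p f = 0].

(* k_o^(t), where k_o is the section of the kernel at [o] *)
Definition proj_kernel (o : obs R d) : obs R d -> R :=
  orth_proj ip mean_zero (gauss_kernel sigma o).

Variables (n : nat) (O : 'I_n -> obs R d).

(* alpha_j^(t) *)
Definition alpha (j : 'I_n) : R := emp_mean O (proj_kernel (O j)).

(* m_n^(t) *)
Definition emp_embedding : obs R d -> R :=
  n%:R^-1 *: \sum_(i < n) proj_kernel (O i).

(* D(p_t) *)
Definition direction : obs R d -> R :=
  n%:R^-1 *: \sum_(j < n) alpha j *: proj_kernel (O j).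

End score.

(* Main.v *)
Require Import Defs.
From HB Require Import structures.
From mathcomp Require Import all_boot all_order all_algebra.
From mathcomp Require Import all_classical all_reals all_analysis.
From mathcomp Require Import ring lra.

(**
Write $m$ for the empirical mean embedding at time $t$. It represents $P_n$ on
the mean-zero subspace $H_t$: $\langle h, m\rangle = P_n h$ for every
$h \in H_t$ ([embedding_mem_reproducing]). Two consequences carry the theorem.

- Averaging the flow equation over the observations gives
  $\frac{d}{dt} P_n[\log p_t] = \frac1n \sum_j \alpha_j^2 \ge 0$
  ([emp_mean_direction]), hence monotonicity, and the derivative vanishes
  exactly when every $\alpha_j$ does.
- Since $\alpha_j = P_n k^{(t)}_{O_j} = \langle k^{(t)}_{O_j}, m\rangle
  = m(O_j)$, the $\alpha_j$ are the values of $m$ at the observations; if they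
  all vanish then $\langle m, m\rangle = P_n m = \frac1n\sum_j m(O_j) = 0$,
  so $m = 0$ ([embedding_eq0]).

All of this rests on $k^{(t)}_o$ being a genuine orthogonal projection, that is,
on $H_t$ being a closed subspace ([closed_subspace_mean_zero]) and on the
projection theorem ([projection_exists]). Closedness holds because
$|f(o)| \le \|f\|$ (the Gaussian kernel is 1 on the diagonal), so that
$f \mapsto \int f p_t$ is a continuous linear form, once every element of the
RKHS is known to be measurable. Measurability is itself obtained from the
projection theorem: the measurable elements form a closed subspace, because
norm convergence implies pointwise convergence, and this subspace contains all
kernel sections, so it is the whole space ([rkhs_sub_closed],
[rkhs_measurable]).
*)

Set Implicit Arguments.
Unset Strict Implicit.
Unset Printing Implicit Defensive.
Import Order.TTheory GRing.Theory Num.Theory numFieldNormedType.Exports.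
Import measurable_realfun.

Local Open Scope classical_set_scope.
Local Open Scope ring_scope.

(** * Inner products and orthogonal projection *)

(** Cauchy-Schwarz and the estimate on near-minimizers in the projection theorem
are both instances of this bound. *)
Lemma discriminant_bound (R : realType) (a b c : R) :
  (forall x, 0 <= x ^+ 2 * a + 2 * x * b + c) -> b ^+ 2 <= a * c.
Proof.
move=> h; set q : {poly R} := a *: 'X^2 + (2 * b) *: 'X + c%:P.
have qE x : q.[x] = x ^+ 2 * a + 2 * x * b + c.
  rewrite !(hornerD, hornerZ, hornerXn, hornerX, hornerC); ring.
have szq : (size q <= 3)%N.
  apply: (leq_trans (size_polyD _ _)); rewrite geq_max.
  rewrite (leq_trans (size_polyC_leq1 _))// andbT.
  apply: (leq_trans (size_polyD _ _)); rewrite geq_max.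
  by rewrite !(leq_trans (size_scale_leq _ _)) ?size_polyXn ?size_polyX.
have := deg_le2_poly_ge0 szq (fun x => (eq_ind_r (fun y => 0 <= y) (h x) (qE x))).
rewrite !(coefD, coefZ, coefXn, coefX, coefC)/= !(mulr0, mulr1, add0r, addr0).
nra.
Qed.

Section closed_subspace.
Variables (R : realType) (T : Type).
Variables (H : set (T -> R)) (ip : (T -> R) -> (T -> R) -> R).

Definition ip_converges (u : nat -> T -> R) f :=
  ip (u k - f) (u k - f) @[k --> \oo] --> (0 : R).

Record closed_subspace (V : set (T -> R)) : Prop := ClosedSubspace {
  closed_subspace_sub : V `<=` H ;
  closed_subspace0 : V 0 ;
  closed_subspaceP : forall a f g, V f -> V g -> V (a *: f + g) ;
  closed_subspace_lim : forall u f, (forall k, V (u k)) -> H f ->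
    ip_converges u f -> V f
}.

End closed_subspace.

Section hilbert.
Context {R : realType} {T : Type}.
Context {H : set (T -> R)} {ip : (T -> R) -> (T -> R) -> R}.
Hypothesis hH : is_hilbert H ip.
Implicit Types f g h : T -> R.

Lemma hilbertD f g : H f -> H g -> H (f + g).
Proof. by move=> Hf Hg; rewrite -[f]scale1r; exact: (hilbertP hH). Qed.

Lemma hilbertZ a f : H f -> H (a *: f).
Proof.
by move=> Hf; rewrite -[_ *: _]addr0; apply: (hilbertP hH) => //; exact: hilbert0 hH.
Qed.

Lemma hilbertB f g : H f -> H g -> H (f - g).
Proof. by move=> Hf Hg; rewrite -scaleN1r addrC; exact: (hilbertP hH). Qed.

Lemma ipDl f g h : H f -> H g -> H h -> ip (f + g) h = ip f h + ip g h.
Proof.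
by move=> Hf Hg Hh; rewrite -[f in LHS]scale1r (hilbert_ipP hH)// mul1r.
Qed.

Lemma ip0l h : H h -> ip 0 h = 0.
Proof.
have H0 := hilbert0 hH.
by move=> Hh; have := ipDl H0 H0 Hh; rewrite addr0; lra.
Qed.

Lemma ipZl a f h : H f -> H h -> ip (a *: f) h = a * ip f h.
Proof.
move=> Hf Hh; have H0 := hilbert0 hH.
by rewrite -[a *: f]addr0 (hilbert_ipP hH)// ip0l// addr0.
Qed.

Lemma ipBl f g h : H f -> H g -> H h -> ip (f - g) h = ip f h - ip g h.
Proof.
move=> Hf Hg Hh; rewrite -scaleN1r ipDl//; last exact: hilbertZ.
by rewrite ipZl// mulN1r.
Qed.

Lemma ip_ge0 f : H f -> 0 <= ip f f.
Proof.
move=> Hf; have [->|f0] := pselect (f = 0).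
  by rewrite ip0l//; exact: hilbert0 hH.
exact/ltW/(hilbert_ip_gt0 hH).
Qed.

Lemma ip_eq0 f : H f -> ip f f = 0 -> f = 0.
Proof.
move=> Hf f0; apply: contrapT => /(hilbert_ip_gt0 hH Hf).
by rewrite f0 ltxx.
Qed.

Lemma ip_line a f g : H f -> H g ->
  ip (a *: f + g) (a *: f + g) = a ^+ 2 * ip f f + 2 * a * ip f g + ip g g.
Proof.
move=> Hf Hg; have Hs : H (a *: f + g) by exact: (hilbertP hH).
rewrite (hilbert_ipP hH)// (hilbert_ipC hH Hf)// (hilbert_ipC hH Hg Hs).
rewrite !(hilbert_ipP hH)// (hilbert_ipC hH Hg Hf); ring.
Qed.

Lemma cauchy_schwarz f g : H f -> H g -> ip f g ^+ 2 <= ip f f * ip g g.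
Proof.
move=> Hf Hg; apply: discriminant_bound => a.
by rewrite -ip_line//; apply: ip_ge0; exact: (hilbertP hH).
Qed.

Section projection.
Variable V : set (T -> R).
Hypothesis cV : closed_subspace H ip V.
Variable f : T -> R.
Hypothesis Hf : H f.

Let VH g : V g -> H g := @closed_subspace_sub _ _ _ _ _ cV g.

Let dist2 := [set r | exists2 h, V h & r = ip (f - h) (f - h)].

Let has_inf_dist2 : has_inf dist2.
Proof.
split; first by exists (ip (f - 0) (f - 0)), 0 => //; exact: closed_subspace0 cV.
by exists 0 => _ [h Vh ->]; apply/ip_ge0/hilbertB => //; exact: VH.
Qed.

Let inf_dist2_le h : V h -> inf dist2 <= ip (f - h) (f - h).
Proof. by move=> Vh; apply: ge_inf; [case: has_inf_dist2|exists h]. Qed.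

(* For u in V the polynomial a |-> ||f - u + a h||^2 stays above the infimum, so
   the discriminant bound says that f - u is nearly orthogonal to V when u is a
   near-minimizer. *)
Let gap_bound u h : V u -> V h ->
  ip (f - u) h ^+ 2 <= ip h h * (ip (f - u) (f - u) - inf dist2).
Proof.
move=> Vu Vh; have Hfu : H (f - u) by apply: hilbertB => //; exact: VH.
rewrite (hilbert_ipC hH) => //; last exact: VH.
apply: discriminant_bound => a; rewrite addrA -ip_line//; last exact: VH.
rewrite subr_ge0; have -> : a *: h + (f - u) = f - (- a *: h + u).
  by rewrite scaleNr opprD opprK addrCA.
by apply: inf_dist2_le; exact: (closed_subspaceP cV).
Qed.

(* With A = ||u - v||^2 = <f - v, u - v> - <f - u, u - v>, the bound above gives
   A^2 <= 2 A (e + e'); dividing by A replaces the usual parallelogram law. *)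
Let minimizer_dist e e' u v : V u -> V v ->
  ip (f - u) (f - u) <= inf dist2 + e -> ip (f - v) (f - v) <= inf dist2 + e' ->
  ip (u - v) (u - v) <= 2 * (e + e').
Proof.
move=> Vu Vv ue ve; have [Hu Hv] := (VH Vu, VH Vv).
have Vuv : V (u - v) by rewrite addrC -scaleN1r; exact: (closed_subspaceP cV).
have Huv := VH Vuv.
have A0 := ip_ge0 Huv.
have := gap_bound Vu Vuv; have := gap_bound Vv Vuv.
have AE : ip (u - v) (u - v) = ip (f - v) (u - v) - ip (f - u) (u - v).
  rewrite -ipBl//; [|exact: hilbertB|exact: hilbertB].
  by congr (ip _ _); rewrite opprB [RHS]addrC addrA subrK.
move: AE A0; set A := ip (u - v) _; set x := ip (f - v) _.
set y := ip (f - u) (u - v).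
move=> AE A0 xA yA.
have [->|A_neq0] := eqVneq A 0.
  have : 0 <= e + e'; last by lra.
  have := inf_dist2_le Vu; have := inf_dist2_le Vv.
  by lra.
have A_gt0 : 0 < A by rewrite lt_neqAle eq_sym A_neq0.
rewrite -(ler_pM2l A_gt0).
have : x ^+ 2 <= A * e' by apply: (le_trans xA); rewrite ler_wpM2l//; lra.
have : y ^+ 2 <= A * e by apply: (le_trans yA); rewrite ler_wpM2l//; lra.
have : A * A <= 2 * (x ^+ 2 + y ^+ 2); last by lra.
by have := sqr_ge0 (x + y); rewrite {1 2}AE; lra.
Qed.

(** The infimum of the squared distance from [f] to [V] is approached along a
minimizing sequence, which is Cauchy; the residuals [f - u k] are nearly
orthogonal to [V] (discriminant bound), and this becomes orthogonality in the
limit. *)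
Lemma projection_exists : exists g, V g /\ forall h, V h -> ip (f - g) h = 0.
Proof.
have /choice[u uP] (k : nat) : exists u, V u /\
    ip (f - u) (f - u) <= inf dist2 + k.+1%:R^-1.
  have k0 : 0 < k.+1%:R^-1 :> R by rewrite invr_gt0.
  have [_ [u Vu ->] /ltW ?] := inf_adherent k0 has_inf_dist2.
  by exists u.
have Vu k : V (u k) by have [] := uP k.
have Hu k : H (u k) by exact: VH.
have uD m k : ip (u m - u k) (u m - u k) <= 2 * (m.+1%:R^-1 + k.+1%:R^-1).
  by apply: minimizer_dist => //; [exact: (uP m).2|exact: (uP k).2].
have [|g Hg ug] := hilbert_complete hH Hu.
  move=> e e0; have e20 : 0 < e ^+ 2 / 4 by rewrite divr_gt0// exprn_gt0.
  have [N _ NP] := near_infty_natSinv_lt (PosNum e20).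
  exists N => m k Nm Nk; rewrite -[ltRHS](ger0_norm (ltW e0)) -sqrtr_sqr.
  rewrite ltr_sqrt ?exprn_gt0//; apply: le_lt_trans (uD _ _) _.
  move: (NP _ Nm) (NP _ Nk) => /=.
  move: (m.+1%:R^-1) (k.+1%:R^-1) (e ^+ 2) => x y z; lra.
have ug2 : ip_converges ip u g.
  rewrite /ip_converges -[0](mulr0 0).
  have -> : (fun k => ip (u k - g) (u k - g)) =
      (fun k => Num.sqrt (ip (u k - g) (u k - g))) \*
      (fun k => Num.sqrt (ip (u k - g) (u k - g))); last exact: (cvgM ug ug).
  by apply/funext => k /=; rewrite -expr2 sqr_sqrtr//; apply/ip_ge0/hilbertB.
exists g; split; first exact: (closed_subspace_lim cV Vu Hg ug2).
move=> h Vh; have Hh := VH Vh.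
(* A majorant of <f - g, h>^2 that tends to 0, from splitting f - g as
   (f - u_k) + (u_k - g). *)
pose w k := 2 * ip h h * (k.+1%:R^-1 + ip (u k - g) (u k - g)).
have w0 : w k @[k --> \oo] --> (0 : R).
  rewrite -(mulr0 (2 * ip h h)); apply: cvgM; first exact: cvg_cst.
  by rewrite -[0]addr0; apply: cvgD ug2; exact: cvg_harmonic.
have hw k : ip (f - g) h ^+ 2 <= w k.
  have -> : f - g = (f - u k) + (u k - g) by rewrite addrA subrK.
  rewrite ipDl//; [|exact: hilbertB|exact: hilbertB].
  have := cauchy_schwarz (hilbertB (Hu k) Hg) Hh.
  have : ip (f - u k) h ^+ 2 <= ip h h * k.+1%:R^-1.
    apply: le_trans (gap_bound (Vu k) Vh) _; rewrite ler_wpM2l ?ip_ge0//.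
    by rewrite lerBlDl; exact: (uP k).2.
  rewrite /w; move: (k.+1%:R^-1) => e; move: (ip (u k - g) (u k - g)) => e'.
  set x := ip (f - u k) h; set y := ip (u k - g) h.
  by have := sqr_ge0 (x - y); nra.
apply/eqP; rewrite -sqrf_eq0 eq_le sqr_ge0 andbT.
apply: (ler_cvg_to (cvg_cst _) w0); exact: nearW.
Qed.

End projection.
End hilbert.

(** * Reproducing kernels of closed subspaces *)

Section rkhs.
Context {R : realType} {T : Type} {K : T -> T -> R}.
Context {H : set (T -> R)} {ip : (T -> R) -> (T -> R) -> R}.
Hypothesis hK : is_rkhs K H ip.

Let hH : is_hilbert H ip := rkhs_hilbert hK.

(** Cauchy-Schwarz for [f] against the kernel section at [x], whose squared norm
is [K x x]. *)
Lemma rkhs_eval_bound f x : H f -> f x ^+ 2 <= ip f f * K x x.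
Proof.
move=> Hf; have HKx := rkhs_kernel hK x.
rewrite -(rkhs_reproducing hK x Hf) -(rkhs_reproducing hK x HKx).
exact: cauchy_schwarz hH _ _ Hf HKx.
Qed.

Lemma ip_converges_pointwise u f x : (forall k, H (u k)) -> H f ->
  ip_converges ip u f -> u k x @[k --> \oo] --> f x.
Proof.
move=> Hu Hf uf; apply/subr_cvg0.
pose b k := Num.sqrt (ip (u k - f) (u k - f) * K x x).
have b0 : b k @[k --> \oo] --> (0 : R).
  rewrite -[0](@sqrtr0 R); apply: continuous_cvg; first exact: sqrt_continuous.
  by rewrite -(mul0r (K x x)); apply: cvgM => //; exact: cvg_cst.
apply/cvgr0Pnorm_lt => e e0; move/cvgr0Pnorm_lt : b0 => /(_ _ e0).
apply: filterS => k; apply: le_lt_trans.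
rewrite [leRHS]ger0_norm ?sqrtr_ge0// -sqrtr_sqr ler_wsqrtr//.
exact/(rkhs_eval_bound x)/(hilbertB hH).
Qed.

(** Kernel sections are total: the residual of the projection of [f] onto [V] is
orthogonal to every section, that is, it vanishes at every point. *)
Lemma rkhs_sub_closed V : closed_subspace H ip V -> (forall x, V (K x)) ->
  H `<=` V.
Proof.
move=> cV VK f Hf; have [g [Vg fg]] := projection_exists hH cV Hf.
have Hg := closed_subspace_sub cV Vg.
suff -> : f = g by [].
apply/funext => x; apply/eqP; rewrite -subr_eq0; apply/eqP.
by rewrite -(fg _ (VK x)) (rkhs_reproducing hK)//; exact: (hilbertB hH).
Qed.

Section reproducing_subspace.
Variable V : set (T -> R).
Hypothesis cV : closed_subspace H ip V.
Let kV x := orth_proj ip V (K x).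

Let kVP x : V (kV x) /\ forall h, V h -> ip (K x - kV x) h = 0.
Proof.
have := projection_exists hH cV (rkhs_kernel hK x).
by move/(xgetPex (0 : T -> R)).
Qed.

Lemma orth_proj_mem x : V (orth_proj ip V (K x)).
Proof. by case: (kVP x). Qed.

(** The projected sections are the reproducing kernel of [V]: the discarded
component of [K x] is orthogonal to [V]. *)
Lemma orth_proj_reproducing h x : V h -> ip h (orth_proj ip V (K x)) = h x.
Proof.
move=> Vh; have [Vk /(_ _ Vh)] := kVP x.
have Hh := closed_subspace_sub cV Vh; have Hk := closed_subspace_sub cV Vk.
have HKx := rkhs_kernel hK x.
rewrite (ipBl hH)// => /eqP; rewrite subr_eq0 => /eqP kE.
by rewrite (hilbert_ipC hH)// -kE (hilbert_ipC hH)// (rkhs_reproducing hK).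
Qed.

Variables (n : nat) (O : 'I_n -> T).
Let embedding := n%:R^-1 *: \sum_(i < n) orth_proj ip V (K (O i)).

(** The embedding is the Riesz representer of the empirical mean on [V]. *)
Lemma embedding_mem_reproducing :
  V embedding /\ forall h, V h -> ip h embedding = emp_mean O h.
Proof.
have VZ a f : V f -> V (a *: f).
  move=> Vf; rewrite -[_ *: _]addr0; apply: (closed_subspaceP cV) => //.
  exact: closed_subspace0 cV.
have VH f : V f -> H f := @closed_subspace_sub _ _ _ _ _ cV f.
suff [Vs sE] : V (\sum_(i < n) kV (O i)) /\ forall h, V h ->
    ip h (\sum_(i < n) kV (O i)) = \sum_(i < n) h (O i).
  split; first exact: VZ.
  move=> h Vh; have Hh := VH _ Vh; have Hs := VH _ Vs.
  rewrite (hilbert_ipC hH) ?(ipZl hH) ?(hilbert_ipC hH Hs) ?sE//.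
  exact: (hilbertZ hH).
(* Membership and representation are propagated together through the sum. *)
pose Q f (r : (T -> R) -> R) := V f /\ forall h, V h -> ip h f = r h.
suff : Q (\sum_(i < n) kV (O i)) (\sum_(i < n) fun h => h (O i)).
  by move=> [Vs sE]; split => // h /sE ->; rewrite fct_sumE.
apply: big_ind2.
- split; first exact: closed_subspace0 cV.
  move=> h /VH Hh; rewrite (hilbert_ipC hH)//; last exact: hilbert0 hH.
  by rewrite (ip0l hH).
- move=> f r g s [Vf fr] [Vg gs]; have [Hf Hg] := (VH _ Vf, VH _ Vg); split.
    by rewrite -[f]scale1r; exact: (closed_subspaceP cV).
  move=> h Vh; have Hh := VH _ Vh; rewrite (hilbert_ipC hH)//; last exact: (hilbertD hH).
  by rewrite (ipDl hH)// (hilbert_ipC hH Hf)// (hilbert_ipC hH Hg)// fr// gs.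
- by move=> i _; split; [exact: orth_proj_mem|move=> h; exact: orth_proj_reproducing].
Qed.

(** Symmetry of the projected kernel, averaged over the observations. *)
Lemma embedding_at x : embedding x = emp_mean O (orth_proj ip V (K x)).
Proof.
have [Vm mE] := embedding_mem_reproducing; have Vk := orth_proj_mem x.
rewrite -mE// -(orth_proj_reproducing x Vm) (hilbert_ipC hH)//.
  exact: closed_subspace_sub cV _ Vm.
exact: closed_subspace_sub cV _ Vk.
Qed.

(** If the values [embedding (O i)] all vanish, then so does their mean, which
is the squared norm of the embedding. *)
Lemma embedding_eq0 : embedding = 0 <->
  forall i, emp_mean O (orth_proj ip V (K (O i))) = 0.
Proof.
split=> [m0 i|m0]; first by rewrite -embedding_at m0.
have [Vm mE] := embedding_mem_reproducing.
apply: (ip_eq0 hH); first exact: closed_subspace_sub cV _ Vm.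
by rewrite mE// /emp_mean big1 ?mulr0// => i _; rewrite embedding_at m0.
Qed.

End reproducing_subspace.
End rkhs.

(** The measurable elements of [H] form a closed subspace, as norm limits are
pointwise limits, and it contains the kernel sections. *)
Lemma rkhs_measurable (R : realType) (disp : measure_display)
    (T : measurableType disp) (K : T -> T -> R) (H : set (T -> R))
    (ip : (T -> R) -> (T -> R) -> R) :
  is_rkhs K H ip -> (forall x, measurable_fun setT (K x)) ->
  forall f, H f -> measurable_fun setT f.
Proof.
move=> hK mK f Hf; have hH := rkhs_hilbert hK.
pose V := [set g | H g /\ measurable_fun setT g].
suff : V f by case.
apply: (rkhs_sub_closed hK) f Hf; last first.
  by move=> x; split; [exact: rkhs_kernel hK x|exact: mK].
split.
- by move=> g [].
- by split; [exact: hilbert0 hH|exact: measurable_cst].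
- move=> a g h [Hg mg] [Hh mh]; split; first exact: (hilbertP hH).
  by apply: measurable_funD => //; exact: measurable_funM.
- move=> u g Vu Hg ug; split => //.
  apply: (@measurable_fun_cvg _ _ _ _ u) => [k|x _]; first exact: (Vu k).2.
  by apply: (ip_converges_pointwise hK) => // k; exact: (Vu k).1.
Qed.

(** * The mean-zero subspace for the Gaussian kernel *)

Section gauss.
Context {R : realType} {d : nat}.
Variable sigma : R.
Local Notation mu := (@obs_measure R d).

Lemma gauss_kernel_diag (o : obs R d) : gauss_kernel sigma o o = 1.
Proof.
rewrite /gauss_kernel /sqdist big1 => [|i _]; last by rewrite subrr expr0n.
by rewrite !subrr expr0n !addr0 oppr0 mul0r expR0.
Qed.

Lemma measurable_gauss_kernel (o : obs R d) :
  measurable_fun setT (gauss_kernel sigma o).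
Proof.
have mi01 : measurable_fun setT (@i01val R).
  by move=> _ B mB; exists B.
have mb : measurable_fun setT (fun b : bool => b%:R : R) by [].
apply: measurableT_comp; first exact: measurable_expR.
apply: measurable_funM => //; apply: measurableT_comp => //.
apply: measurable_funD; [apply: measurable_funD|].
- apply: measurable_sum => i; apply: measurable_funX; apply: measurable_funB => //.
  apply: (measurableT_comp mi01).
  apply: (measurableT_comp (measurable_tnth i)).
  exact: measurableT_comp.
- apply: measurable_funX; apply: measurable_funB => //.
  by apply: (measurableT_comp mb); exact: measurableT_comp.
- apply: measurable_funX; apply: measurable_funB => //.
  exact: (measurableT_comp mb).
Qed.

Context {H : set (obs R d -> R)} {ip : (obs R d -> R) -> (obs R d -> R) -> R}.
Hypothesis hK : is_rkhs (gauss_kernel sigma) H ip.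
Variable p : obs R d -> R.
Hypothesis dp : is_density p.

Let hH : is_hilbert H ip := rkhs_hilbert hK.

Let integrable_density : mu.-integrable setT (EFin \o p).
Proof.
have [mp p0 p1] := dp; apply/integrableP; split; first exact/measurable_EFinP.
rewrite (_ : (\int[_]_(x in _) _ = 1)%E) ?ltry// -p1.
by apply: eq_integral => o _ /=; rewrite ger0_norm.
Qed.

Let f_bound f o : H f -> `|f o| <= Num.sqrt (ip f f).
Proof.
move=> Hf; rewrite -sqrtr_sqr ler_wsqrtr//.
by have := rkhs_eval_bound hK o Hf; rewrite gauss_kernel_diag mulr1.
Qed.

Let integrable_mean f : H f ->
  mu.-integrable setT (EFin \o (fun o => f o * p o)).
Proof.
move=> Hf; have [mp p0 _] := dp.
apply: (@le_integrable _ _ _ _ setT _ _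
  (EFin \o (fun o => Num.sqrt (ip f f) * p o))) => //.
- apply/measurable_EFinP/measurable_funM => //.
  exact: rkhs_measurable hK measurable_gauss_kernel _ Hf.
- move=> o _; rewrite /= lee_fin !normrM ler_wpM2r// [leRHS]ger0_norm ?sqrtr_ge0//.
  exact: f_bound.
- exact: (integrableZl measurableT _ integrable_density).
Qed.

Let density_meanP a f g : H f -> H g ->
  density_mean p (a *: f + g) = a * density_mean p f + density_mean p g.
Proof.
move=> Hf Hg; rewrite /density_mean.
rewrite -RintegralZl// ?integrable_mean// -RintegralD ?integrable_mean//.
  by apply: eq_Rintegral => o _; rewrite mulrDl mulrA.
have := integrable_mean (hilbertZ hH a Hf).
by congr integrable; apply/funext => o /=; rewrite mulrA.
Qed.

Let density_mean_bound f : H f -> `|density_mean p f| <= Num.sqrt (ip f f).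
Proof.
move=> Hf; have [mp p0 p1] := dp.
apply: le_trans (le_normr_Rintegral _ _) _ => //; first exact: integrable_mean.
have -> : Num.sqrt (ip f f) = \int[mu]_o (Num.sqrt (ip f f) * p o).
  by rewrite RintegralZl// /Rintegral p1 mulr1.
apply: le_Rintegral => //.
- have /integrable_abse := integrable_mean Hf; exact.
- exact: (integrableZl measurableT _ integrable_density).
- by move=> o _; rewrite normrM (ger0_norm (p0 o)) ler_wpM2r// f_bound.
Qed.

(** The mean is a linear form of norm at most 1 on [H], because evaluations are
bounded by the norm and the density has total mass 1; its kernel is therefore
closed. *)
Lemma closed_subspace_mean_zero : closed_subspace H ip (mean_zero H p).
Proof.
split.
- by move=> f [].
- split; first exact: hilbert0 hH.
  rewrite /density_mean; under eq_Rintegral do rewrite mul0r.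
  by rewrite Rintegral_cst// mul0r.
- move=> a f g [Hf f0] [Hg g0]; split; first exact: (hilbertP hH).
  by rewrite density_meanP// f0 g0 mulr0 addr0.
- move=> u f Vu Hf uf; split => //.
  have Hu k : H (u k) by case: (Vu k).
  have b k : density_mean p f ^+ 2 <= ip (u k - f) (u k - f).
    have Huf := hilbertB hH (Hu k) Hf.
    have := density_mean_bound Huf.
    rewrite addrC -scaleN1r density_meanP// (Vu k).2 addr0 mulN1r normrN.
    rewrite scaleN1r addrC => h.
    rewrite -real_normK ?num_real// -(sqr_sqrtr (ip_ge0 hH Huf)).
    by rewrite lerXn2r ?nnegrE ?sqrtr_ge0.
  apply/eqP; rewrite -sqrf_eq0 eq_le sqr_ge0 andbT.
  by apply: (ler_cvg_to (cvg_cst _) uf); exact: nearW.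
Qed.

End gauss.

(** * The empirical log-likelihood along the flow *)

Lemma emp_meanZ (R : realType) (T : Type) (n : nat) (O : 'I_n -> T) (a : R)
    (f : T -> R) : emp_mean O (a *: f) = a * emp_mean O f.
Proof. by rewrite /emp_mean mulrCA; congr (_ * _); rewrite mulr_sumr. Qed.

Lemma emp_mean_sum (R : realType) (T : Type) (n m : nat) (O : 'I_n -> T)
    (F : 'I_m -> T -> R) :
  emp_mean O (\sum_(j < m) F j) = \sum_(j < m) emp_mean O (F j).
Proof.
rewrite /emp_mean -mulr_sumr exchange_big; congr (_ * _).
by apply: eq_bigr => i _; rewrite fct_sumE.
Qed.

(** Averaging [proj_kernel (O j)] over the observations gives back its own
coefficient [alpha j] in the direction, hence the squares. *)
Lemma emp_mean_direction (R : realType) (d n : nat) (sigma : R)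
    (H : set (obs R d -> R)) (ip : (obs R d -> R) -> (obs R d -> R) -> R)
    (p : obs R d -> R) (O : 'I_n -> obs R d) :
  emp_mean O (direction sigma H ip p O) =
  n%:R^-1 * \sum_(j < n) alpha sigma H ip p O j ^+ 2.
Proof.
rewrite /direction emp_meanZ emp_mean_sum; congr (_ * _).
by apply: eq_bigr => j _; rewrite emp_meanZ expr2.
Qed.

Lemma is_derive_emp_loglik (R : realType) (T : Type) (n : nat) (O : 'I_n -> T)
    (p : R -> T -> R) (t : R) :
  (forall o, 0 < p t o) -> (forall o, derivable (p ^~ o) t 1) ->
  is_derive t 1 (emp_loglik O p)
    (emp_mean O (fun o => derive1 (fun s => ln (p s o)) t)).
Proof.
move=> p0 dp; have dl i : is_derive t 1 (fun s => ln (p s (O i)))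
    (derive1 (fun s => ln (p s (O i))) t).
  have dln := is_derive1_ln (p0 (O i)).
  have dpi : is_derive t 1 (p ^~ (O i)) ('D_1 (p ^~ (O i)) t) by exact/derivableP.
  have dlnp := is_derive1_comp dln dpi.
  by rewrite derive1E; apply: derivableP; case: dlnp.
rewrite (_ : emp_loglik O p =
    n%:R^-1 \*: \sum_(i < n) (fun s => ln (p s (O i)))).
  by rewrite /emp_mean; apply: is_deriveZ; apply: is_derive_sum.
by apply/funext => s /=; rewrite fct_sumE.
Qed.

Lemma sum_sqr_eq0 (R : realType) (n : nat) (a : 'I_n -> R) :
  (\sum_(j < n) a j ^+ 2 = 0) <-> (forall j, a j = 0).
Proof.
split=> [s0 j|a0]; last by rewrite big1// => j _; rewrite a0 expr0n.
apply/eqP; rewrite -sqrf_eq0; apply/eqP.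
by apply: (psumr_eq0P _ s0) => // i _; exact: sqr_ge0.
Qed.

Theorem lemma6p2 (R : realType) (d n : nat) (hn : (0 < n)%N)
    (sigma : R) (hsigma : 0 < sigma)
    (HK : set (obs R d -> R)) (ip : (obs R d -> R) -> (obs R d -> R) -> R)
    (hHK : is_rkhs (gauss_kernel sigma) HK ip)
    (O : 'I_n -> obs R d)
    (I : set R) (openI : open I) (itvI : is_interval I)
    (p : R -> obs R d -> R)
    (p_density : forall t, I t -> is_density (p t))
    (p_gt0 : forall (o : obs R d) t, I t -> 0 < p t o)
    (p_derivable : forall (o : obs R d) t, I t -> derivable (fun s => p s o) t 1)
    (p_flow : forall (o : obs R d) t, I t ->
      derive1 (fun s => ln (p s o)) t = direction sigma HK ip (p t) O o) :
  (forall s t, I s -> I t -> s <= t -> emp_loglik O p s <= emp_loglik O p t) /\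
  (forall t1, I t1 ->
    derivable (emp_loglik O p) t1 1 /\
    (derive1 (emp_loglik O p) t1 = 0 <->
     emp_embedding sigma HK ip (p t1) O = 0)).
Proof.
have dlogp t : I t -> is_derive t 1 (emp_loglik O p)
    (n%:R^-1 * \sum_(j < n) alpha sigma HK ip (p t) O j ^+ 2).
  move=> It; rewrite -emp_mean_direction.
  rewrite (_ : direction _ _ _ _ _ = fun o => derive1 (fun s => ln (p s o)) t).
    by apply: is_derive_emp_loglik => o; [exact: p_gt0|exact: p_derivable].
  by apply/funext => o; rewrite p_flow.
have derivable_loglik t : I t -> derivable (emp_loglik O p) t 1.
  by move=> /dlogp [].
have loglik' t : I t -> derive1 (emp_loglik O p) t =
    n%:R^-1 * \sum_(j < n) alpha sigma HK ip (p t) O j ^+ 2.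
  by move=> /dlogp dt; rewrite derive1E; exact: derive_val.
split=> [s t Is It st|t It].
  have itvst x : x \in `[s, t] -> I x by rewrite in_itv/=; exact: itvI.
  have sub x : x \in `]s, t[ -> I x by move/subset_itv_oo_cc; exact: itvst.
  apply: (@ger0_derive1_le_cc _ _ s t) => //; rewrite ?in_itv/= ?lexx ?st//.
  - by move=> x /sub; exact: derivable_loglik.
  - move=> x /sub /loglik' ->; rewrite mulr_ge0// ?invr_ge0//.
    by apply: sumr_ge0 => j _; exact: sqr_ge0.
  - by apply: derivable_within_continuous => x /itvst; exact: derivable_loglik.
split; first exact: derivable_loglik.
have cV := closed_subspace_mean_zero hHK (p_density _ It).
have nV0 : n%:R^-1 != 0 :> R by rewrite invr_eq0 pnatr_eq0 -lt0n.
rewrite (loglik' _ It); split=> [/eqP|/(embedding_eq0 hHK cV)/sum_sqr_eq0 a0].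
  rewrite mulf_eq0 (negbTE nV0)/= => /eqP/sum_sqr_eq0.
  by move/(embedding_eq0 hHK cV).
by rewrite [X in _ * X]a0 mulr0.
Qed.
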